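(* For every $\omega\in\{0,1\}^{\infty}$, the orbital Schreier graph $\Gamma_\omega$ of the group $G$ has intermediate growth.
   Context: $\{0,1\}^{\infty}$ is the set of infinite sequences $x_1x_2\ldots$ with $x_i\in\{0,1\}$. The group $G$. $G$ is the group generated by the two bijections $a,b$ of $\{0,1\}^\infty$ defined recursively by $a(0w)=1w$, $a(1w)=0\,a(w)$, $b(0w)=0\,b(w)$, $b(1w)=1\,a(w)$ for all $w\in\{0,1\}^\infty$. For $\omega\in\{0,1\}^\infty$, the orbital Schreier graph $\Gamma_\omega$ is the (connected, undirected) graph whose vertex set is the orbit $G(\omega)$, with an edge between $v$ and $s(v)$ for each $v\in G(\omega)$ and $s\in\{a,b\}$. Growth. Let $X$ be a connected graph of uniformly bounded valence. For a vertex $v$, the growth function is $\gamma_v(n)=|B(v,n)|$, the number of vertices at graph distance at most $n$ from $v$. For functions $f,g$ on $\mathbb{N}\cup\{0\}$ with non-negative values write $f\prec g$ if there exist a constant $C>0$ (an integer, so that $g(Cn)$ is defined) and an integer $n_0$ such that $f(n)\le g(Cn)$ for all $n\ge n_0$, and $f\sim g$ if $f\prec g$ and $g\prec f$. The $\sim$-class $\gamma$ of $\gamma_v$ does not depend on $v$ and is called the growth of $X$. $X$ has intermediate growth if $P\precnsim\gamma\precnsim E$ (i.e. $\prec$ but not $\sim$) for every polynomial $P$ (non-negative on $\mathbb{N}\cup\{0\}$) and every exponential function $E(n)=a^n$, $a>1$ real. *)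

(* Defs.v *)
From mathcomp Require Import all_boot all_order all_algebra finmap.
From mathcomp Require Import all_classical all_reals.

Set Implicit Arguments.
Unset Strict Implicit.
Unset Printing Implicit Defensive.

Import Order.TTheory GRing.Theory Num.Theory.
Local Open Scope classical_set_scope.

(* A binary sequence x_1 x_2 ... is stored with x_i at index i - 1; the letters
   0 and 1 are false and true. *)
Definition binseq := nat -> bool.

Definition scons (x : bool) (w : binseq) : binseq :=
  fun n => if n is m.+1 then w m else x.

Definition stail (w : binseq) : binseq := fun n => w n.+1.

(* The defining recursions are act_a0, act_a1, act_b0 and act_b1 below; here
   they are run coordinate by coordinate. *)
Fixpoint act_a_at (n : nat) (w : binseq) : bool :=
  match n with
  | 0 => ~~ w 0
  | m.+1 => if w 0 then act_a_at m (stail w) else w m.+1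
  end.
Definition act_a (w : binseq) : binseq := fun n => act_a_at n w.

Fixpoint act_b_at (n : nat) (w : binseq) : bool :=
  match n with
  | 0 => w 0
  | m.+1 => if w 0 then act_a_at m (stail w) else act_b_at m (stail w)
  end.
Definition act_b (w : binseq) : binseq := fun n => act_b_at n w.

Lemma act_a0 w : act_a (scons false w) = scons true w.
Proof. by apply/funext; case. Qed.

Lemma act_a1 w : act_a (scons true w) = scons false (act_a w).
Proof. by apply/funext; case. Qed.

Lemma act_b0 w : act_b (scons false w) = scons false (act_b w).
Proof. by apply/funext; case. Qed.

Lemma act_b1 w : act_b (scons true w) = scons true (act_a w).
Proof. by apply/funext; case. Qed.

(* When the elements of S are bijections of T, this is the subgroup of Sym(T)
   generated by S. *)
Inductive generated (T : Type) (S : set (T -> T)) : set (T -> T) :=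
| generated_gen f : S f -> generated S f
| generated_id : generated S id
| generated_comp f g :
    generated S f -> generated S g -> generated S (f \o g)
| generated_inv f g :
    generated S f -> cancel f g -> cancel g f -> generated S g.

Definition G : set (binseq -> binseq) := generated [set act_a; act_b].

Lemma scons_eta w : scons (w 0) (stail w) = w.
Proof. by apply/funext; case. Qed.

Fixpoint inv_a_at (n : nat) (w : binseq) : bool :=
  match n with
  | 0 => ~~ w 0
  | m.+1 => if w 0 then w m.+1 else inv_a_at m (stail w)
  end.

Fixpoint inv_b_at (n : nat) (w : binseq) : bool :=
  match n with
  | 0 => w 0
  | m.+1 => if w 0 then inv_a_at m (stail w) else inv_b_at m (stail w)
  end.

Lemma act_aK : cancel act_a (fun w n => inv_a_at n w).
Proof.
move=> w; apply/funext => n; elim: n w => [|n IHn] w; first exact: negbK.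
rewrite -(scons_eta w); case: (w 0) => //.
exact: IHn (stail w).
Qed.

Lemma inv_aK : cancel (fun w n => inv_a_at n w) act_a.
Proof.
move=> w; apply/funext => n; elim: n w => [|n IHn] w; first exact: negbK.
rewrite -(scons_eta w); case: (w 0) => //.
exact: IHn (stail w).
Qed.

Lemma act_bK : cancel act_b (fun w n => inv_b_at n w).
Proof.
move=> w; apply/funext => n; elim: n w => [|n IHn] w //.
rewrite -(scons_eta w); case: (w 0); last exact: IHn (stail w).
exact: (congr1 (fun v : binseq => v n) (act_aK (stail w))).
Qed.

Lemma inv_bK : cancel (fun w n => inv_b_at n w) act_b.
Proof.
move=> w; apply/funext => n; elim: n w => [|n IHn] w //.
rewrite -(scons_eta w); case: (w 0); last exact: IHn (stail w).
exact: (congr1 (fun v : binseq => v n) (inv_aK (stail w))).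
Qed.

Lemma act_a_bij : bijective act_a.
Proof. exact: Bijective act_aK inv_aK. Qed.

Lemma act_b_bij : bijective act_b.
Proof. exact: Bijective act_bK inv_bK. Qed.

Lemma G_bij g : G g -> bijective g.
Proof.
elim=> {g} [f [->|->]||f g _ bf _ bg|f g _ _ fK gK].
- exact: act_a_bij.
- exact: act_b_bij.
- by exists id.
- exact: bij_comp.
- exact: Bijective gK fK.
Qed.

Definition orbit (omega : binseq) : set binseq := [set g omega | g in G].

(* An undirected multigraph: loops and multiple edges are allowed, and the order
   of the two ends of an edge is irrelevant. *)
Record graph := Graph {
  vertex : choiceType;
  edge : Type;
  ends : edge -> vertex * vertex }.

Section Graphs.
Variable X : graph.
Implicit Types u v w : vertex X.

Definition adj u v :=
  exists e : edge X, ends e = (u, v) \/ ends e = (v, u).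

Fixpoint walk (n : nat) u v : Prop :=
  match n with
  | 0 => u = v
  | m.+1 => exists2 w, adj u w & walk m w v
  end.

Lemma walk_cat m n u v w : walk m u v -> walk n v w -> walk (m + n) u w.
Proof.
elim: m u => [|m IHm] u /=; first by move=> ->.
by case=> x ux xv vw; exists x => //; exact: IHm.
Qed.

Definition connected := forall u v, exists n, walk n u v.

Definition bounded_valence := exists d : nat, forall v,
  ([set e : edge X | (ends e).1 = v \/ (ends e).2 = v] #<= `I_d)%card.

Definition distance_is u v (d : nat) :=
  walk d u v /\ forall k, walk k u v -> (d <= k)%N.

Definition ball v (n : nat) : set (vertex X) :=
  [set u | exists2 d, distance_is v u d & (d <= n)%N].

(* fset_set sends infinite sets to the empty one; balls are finite in a graph of
   bounded valence, see finite_ball. *)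
Definition growth_fun v (n : nat) : nat := #|` fset_set (ball v n)|.

Lemma ballP v n u : ball v n u <-> exists2 k, (k <= n)%N & walk k v u.
Proof.
split=> [[d [wd _] dn]|[k kn wk]]; first by exists d.
have ex : exists k, `[< walk k v u >] by exists k; apply/asboolP.
exists (ex_minn ex); case: ex_minnP => d /asboolP wd dmin.
  by split=> // j wj; apply: dmin; apply/asboolP.
by rewrite (leq_trans _ kn)//; apply: dmin; apply/asboolP.
Qed.

Lemma finite_ball v n : bounded_valence -> finite_set (ball v n).
Proof.
move=> [d hd].
have fin_adj u : finite_set [set w | adj u w].
  pose E := [set e : edge X | (ends e).1 = u \/ (ends e).2 = u].
  have finE : finite_set E.
    exact: card_le_finite (hd u) (finite_II d).
  apply: (@sub_finite_set _ _
    ([set (ends e).1 | e in E] `|` [set (ends e).2 | e in E])).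
    move=> w [e [he|he]]; [right|left]; exists e; rewrite /E /= ?he//=.
      by left.
    by right.
  by rewrite finite_setU; split; exact: finite_image.
have fin_walk k u : finite_set [set w | walk k u w].
  elim: k u => [|k IHk] u /=.
    by apply: sub_finite_set (finite_set1 u) => w ->.
  apply: (@sub_finite_set _ _
    (\bigcup_(x in [set x | adj u x]) [set w | walk k x w])).
    by move=> w [x ux xw]; exists x.
  by apply: bigcup_finite.
apply: (@sub_finite_set _ _ (\bigcup_(k in `I_n.+1) [set w | walk k v w])).
  by move=> u /ballP[k kn wk]; exists k.
by apply: bigcup_finite => //; exact: finite_II.
Qed.

End Graphs.

Section Growth.
Local Open Scope ring_scope.
Variable R : realType.
Implicit Types f g : nat -> R.

Definition prec f g := exists C n0 : nat,
  (0 < C)%N /\ forall n : nat, (n0 <= n)%N -> f n <= g (C * n)%N.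

Definition growth_sim f g := prec f g /\ prec g f.

Definition precnsim f g := prec f g /\ ~ growth_sim f g.

(* The growth of X is the growth_sim-class of growth_fun v for any v; that it
   does not depend on v is growth_fun_sim below. *)
Definition intermediate_growth (X : graph) :=
  forall v : vertex X,
  let gamma := fun n => (growth_fun v n)%:R : R in
  (forall P : {poly R}, (forall n : nat, 0 <= P.[n%:R]) ->
     precnsim (fun n => P.[n%:R]) gamma) /\
  (forall a : R, 1 < a -> precnsim gamma (fun n => a ^+ n)).

Lemma growth_fun_sim (X : graph) (u v : vertex X) :
  connected X -> bounded_valence X ->
  growth_sim (fun n => (growth_fun u n)%:R) (fun n => (growth_fun v n)%:R).
Proof.
move=> cX bX.
have H (x y : vertex X) :
    prec (fun n => (growth_fun x n)%:R) (fun n => (growth_fun y n)%:R).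
  have [d yx] := cX y x.
  exists d.+1, 1%N; split=> // n n1; rewrite ler_nat.
  apply: fsubset_leq_card; rewrite -fset_set_sub; try exact: finite_ball.
  move=> w /ballP[k kn xw]; apply/ballP; exists (d + k)%N; last first.
    exact: walk_cat yx xw.
  by rewrite mulSn addnC leq_add// leq_pmulr.
by split; apply: H.
Qed.

End Growth.

Definition act (s : bool) : binseq -> binseq := if s then act_b else act_a.

Lemma orbit_act omega (v : orbit omega) s : orbit omega (act s (\val v)).
Proof.
have [g Gg <-] := set_mem (valP v); exists (act s \o g) => //.
by apply: generated_comp Gg; apply: generated_gen; case: s; [right|left].
Qed.

Definition vertex_act omega (s : bool) (v : orbit omega) : orbit omega :=
  exist _ (act s (\val v)) (mem_set (orbit_act v s)).

(* One edge for every pair (v, s), joining v to s(v). *)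
Definition Schreier (omega : binseq) : graph :=
  @Graph (orbit omega) (orbit omega * bool)
    (fun e => (e.1, vertex_act e.2 e.1)).

Lemma Schreier_bounded omega : bounded_valence (Schreier omega).
Proof.
have act_inj s : injective (act s).
  by case: s; apply: bij_inj; [exact: act_b_bij|exact: act_a_bij].
exists 4%N => v; set E := [set _ | _].
pose c (e : edge (Schreier omega)) : nat := (2 * (e.1 == v) + e.2)%N.
have c_inj : {in E &, injective c}; last first.
  rewrite -(card_le_eql (inj_card_eq c_inj)); apply: subset_card_le.
  by move=> _ [e _ <-]; rewrite /c /=; case: (e.1 == v); case: e.2.
move=> [x s] [y t] /set_mem /= hx /set_mem /= hy; rewrite /c /=.
have tgtK (z : orbit omega) r :
    z = v \/ vertex_act r z = v -> z != v -> vertex_act r z = v.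
  by case=> [->|//]; rewrite eqxx.
case: eqP hx hy => [->|/eqP xv] hx hy; case: eqP hy => [->|/eqP yv] hy;
  case: s t hx hy => -[] //= hx hy _; apply: congr2 => //; apply: val_inj.
- apply: (act_inj true); have := tgtK _ _ hx xv.
  by rewrite -(tgtK _ _ hy yv) => /(congr1 val).
- apply: (act_inj false); have := tgtK _ _ hx xv.
  by rewrite -(tgtK _ _ hy yv) => /(congr1 val).
Qed.

Lemma Schreier_connected omega : connected (Schreier omega).
Proof.
have adj_sym (x y : vertex (Schreier omega)) : adj x y -> adj y x.
  by case=> e [|]; exists e; [right|left].
have walk_sym m (x y : vertex (Schreier omega)) : walk m x y -> walk m y x.
  elim: m x => [|m IHm] x /=; first by move=> ->.
  case=> w xw /IHm yw; have := @walk_cat _ _ 1%N _ _ x yw.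
  by rewrite addn1; apply; exists x => //; exact: adj_sym.
have main g : G g -> forall x y : vertex (Schreier omega),
    g (\val x) = \val y -> exists n, walk n x y.
  have step s (x y : orbit omega) : act s (\val x) = \val y ->
      exists n, @walk (Schreier omega) n x y.
    move=> xy; exists 1%N, y => //; exists (x, s); left => /=.
    by congr pair; apply: val_inj.
  elim=> {g} [f [->|->]||f g Gf IHf Gg IHg|f g Gf IHf fK gK] x y.
  - exact: (step false).
  - exact: (step true).
  - by move=> /val_inj ->; exists 0%N.
  - move=> /= xy.
    have oz : orbit omega (g (\val x)).
      have [h Gh <-] := set_mem (valP x).
      by exists (g \o h) => //; exact: generated_comp.
    pose z : orbit omega := exist _ (g (\val x)) (mem_set oz).
    have [m xm] := IHg x z erefl.
    have [n ny] := IHf z y xy.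
    by exists (m + n)%N; exact: walk_cat xm ny.
  - move=> xy; have [n yx] : exists n, walk n y x by apply: IHf; rewrite -xy gK.
    by exists n; exact: walk_sym.
move=> x y.
have [g Gg gx] := set_mem (valP x); have [h Gh hy] := set_mem (valP y).
have [k gk kg] := G_bij Gg.
apply: (main (h \o k)) => //=; last by rewrite -gx gk.
by apply: generated_comp => //; exact: generated_inv gk kg.
Qed.

(* Main.v *)
(* Read a sequence as a 2-adic integer x. Then a is x |-> x + 1 and b is
   x |-> x + 2^(j+1), where j is the valuation of x, so the orbit is omega + Z and
   the points of valuation j are joined along a line with steps 2^(j+1).
   Lower bound: to go from x to x + i with i <= 2^(k+t), climb to a point of
   valuation k - 1 less than 2^k away, follow its line, and walk the remaining
   distance, which is less than 2^k; this costs 2 D + 2^t if D is enough for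
   i <= 2^k. Iterating, radius O(2^m) reaches 2^(t m) points, for every t.
   Upper bound: a walk shorter than 2^i that leaves a point divisible by
   2^(i(i+1)/2) and uses only links of smaller level cannot end at another such
   point. Hence a walk shorter than 2^i uses at most one line of high level, its
   end is one of 2^(O(i^2)) translates of its origin, and submultiplicativity of
   ball sizes turns this into subexponential growth. *)
Require Import Defs.
From mathcomp Require Import all_boot all_order all_algebra finmap.
From mathcomp Require Import all_classical all_reals.
From mathcomp Require Import zify lra.

Set Implicit Arguments.
Unset Strict Implicit.
Unset Printing Implicit Defensive.

Import Order.TTheory GRing.Theory Num.Theory.
Local Open Scope ring_scope.
Local Open Scope classical_set_scope.

(** * The orbit as a copy of the integers *)

Definition inv_a (w : binseq) : binseq := fun n => inv_a_at n w.

Definition shift (z : int) (w : binseq) : binseq :=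
  match z with
  | Posz n => iter n act_a w
  | Negz n => iter n.+1 inv_a w
  end.

Lemma shift_succ z w : shift (z + 1) w = act_a (shift z w).
Proof.
case: z => [n|[|n]]; first by rewrite -PoszD addn1.
  by rewrite /= inv_aK.
have -> : Negz n.+1 + 1 = Negz n by lia.
by rewrite [RHS]/= inv_aK.
Qed.

Lemma shift_pred z w : shift (z - 1) w = inv_a (shift z w).
Proof.
by rewrite -[z in RHS](subrK 1) shift_succ [inv_a _]act_aK.
Qed.

Lemma shiftD z y w : shift (z + y) w = shift z (shift y w).
Proof.
elim: z => [|n IHn|n IHn]; first by rewrite add0r.
  by rewrite -addn1 PoszD addrAC !shift_succ IHn.
by rewrite -addn1 PoszD opprD addrAC !shift_pred IHn.
Qed.

(** Two applications of [act_a] keep the first letter and apply [act_a] once to the tail. *)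
Lemma shift_double z x w : shift (z * 2) (scons x w) = scons x (shift z w).
Proof.
have step y : shift (y + 2) (scons x w) = act_a (act_a (shift y (scons x w))).
  by rewrite -!shift_succ -addrA.
have aa u : act_a (act_a (scons x u)) = scons x (act_a u).
  by case: x {step}; rewrite ?(act_a0, act_a1).
elim: z => [|n IHn|n IHn]; first by rewrite mul0r.
  by rewrite -addn1 PoszD mulrDl mul1r step IHn aa -shift_succ.
apply: (bij_inj act_a_bij); apply: (bij_inj act_a_bij).
rewrite -step aa -shift_succ.
have -> : - n.+1%:Z * 2 + 2 = - n%:Z * 2 by lia.
by have -> : - n.+1%:Z + 1 = - n%:Z by lia.
Qed.

Lemma shift_even z w : shift (z * 2) w = scons (w 0%N) (shift z (stail w)).
Proof. by rewrite -{1}(scons_eta w) shift_double. Qed.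

(** An odd shift flips the first letter, so agreement there makes [z] even; half of [z] then acts on
    the tail, with one letter fewer to compare. *)
Lemma shift_dvd k z w :
  (forall i, (i < k)%N -> shift z w i = w i) -> ((2 ^ k)%:Z %| z)%Z.
Proof.
elim: k z w => [|k IHk] z w eq_zw; first by rewrite expn0 dvd1z.
have [y zE] : exists y : int, z = y * 2 \/ z = y * 2 + 1.
  by exists (z %/ 2)%Z; lia.
have := eq_zw 0%N isT; case: zE => zE; rewrite zE.
  move=> _; rewrite expnSr PoszM dvdz_mul ?dvdzz//.
  apply: (IHk _ (stail w)) => i ik.
  by have := eq_zw i.+1 ik; rewrite zE shift_even.
by rewrite shift_succ shift_even /=; case: (w 0%N).
Qed.

Lemma shift_inj w : injective (shift^~ w).
Proof.
suff fix0 z u : shift z u = u -> z = 0.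
  move=> z y /= zy; apply/eqP; rewrite -subr_eq0; apply/eqP/(fix0 _ (shift y w)).
  by rewrite -shiftD subrK.
(* A shift that fixes [u] is divisible by every power of 2, and 2^|z| already exceeds |z|. *)
move=> zu; have : ((2 ^ `|z|)%:Z %| z)%Z by apply: (@shift_dvd _ _ u); rewrite zu.
move=> /dvdzP[q zq]; have := ltn_expl `|z| (isT : (1 < 2)%N).
move: zq; case: (eqVneq q 0) => [->|]; first by rewrite mul0r.
move: (2 ^ `|z|)%N; nia.
Qed.

(* [zeros k w]: 2^k divides the 2-adic integer w; [lead j w]: its valuation is
   exactly j. *)
Definition zeros (k : nat) (w : binseq) := forall i, (i < k)%N -> w i = false.
Definition lead (j : nat) (w : binseq) := zeros j w /\ w j = true.

Lemma leadS j x w : lead j.+1 (scons x w) <-> ~~ x /\ lead j w.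
Proof.
split=> [[z1 wj]|[/negbTE x0 [z1 wj]]].
  split; first by rewrite -[x]/(scons x w 0%N) z1.
  by split=> // i ij; apply: (z1 i.+1).
by split=> // -[|i] // ij; apply: z1.
Qed.

Lemma leadSP j w : lead j.+1 w <-> ~~ w 0%N /\ lead j (stail w).
Proof. by rewrite -{1}(scons_eta w) leadS. Qed.

(** [act_b] passes over the leading zeros and applies [act_a] just after the first 1, at index
    [j.+1], where adding one weighs 2^(j+1). *)
Lemma act_b_lead j w : lead j w -> act_b w = shift (2 ^ j.+1)%:Z w.
Proof.
elim: j w => [|j IHj] w.
  move=> [_ w1]; rewrite -(scons_eta w) w1 act_b1.
  by have -> : (2 ^ 1)%:Z = 1 * 2 by []; rewrite shift_double.
move=> /leadSP[/negbTE w0 lw]; rewrite -(scons_eta w) w0 act_b0 (IHj _ lw).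
by rewrite (expnSr _ j.+1) PoszM shift_double.
Qed.

Lemma lead_shift j z w : lead j w -> lead j (shift (z * (2 ^ j.+1)%:Z) w).
Proof.
elim: j w => [|j IHj] w; first by rewrite expn1 shift_even => -[_ w1]; split.
move=> /leadSP[w0 lw]; rewrite (expnSr _ j.+1) PoszM mulrA shift_even.
by apply/leadS; split=> //; apply: IHj.
Qed.

(** Valuation j means lying in the class of 2^j modulo 2^(j+1), which any 2^(j+1) consecutive shifts
    meet. *)
Lemma lead_reach j w : exists2 p, (p < 2 ^ j.+1)%N & lead j (shift p%:Z w).
Proof.
elim: j w => [|j IHj] w.
  case w0: (w 0%N); [by exists 0%N|exists 1%N => //].
  by split=> //=; rewrite /act_a /= w0.
case w0: (w 0%N).
  have [p p2 lp] := IHj (act_a (stail w)).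
  exists (p * 2).+1; first by rewrite expnSr; lia.
  rewrite -[(p * 2).+1]addn1 PoszD shiftD PoszM shift_even leadS /=.
  by split; [rewrite /act_a /= w0|rewrite -(scons_eta w) w0 act_a1].
have [p p2 lp] := IHj (stail w).
exists (p * 2)%N; first by rewrite expnSr; lia.
by rewrite PoszM shift_even leadS w0.
Qed.

Lemma lead_zeros k j w : lead j w -> (k <= j)%N -> zeros k w.
Proof. by move=> [z1 _] kj i ik; apply: z1; apply: leq_trans kj. Qed.

Lemma lead_nzeros k j w : lead j w -> (j < k)%N -> ~ zeros k w.
Proof. by move=> [_ wj] jk /(_ j jk); rewrite wj. Qed.

Lemma lead_inj i j w : lead i w -> lead j w -> i = j.
Proof.
move=> li lj; have [ij|ji|//] := ltngtP i j.
  by case: (lead_nzeros li (leqnn _) (lead_zeros lj ij)).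
by case: (lead_nzeros lj (leqnn _) (lead_zeros li ji)).
Qed.

Lemma act_b_cases w : act_b w = w \/ exists j, lead j w.
Proof.
have [[n wn]|w0] := pselect (exists n, w n).
  by right; case: (ex_minnP (ex_intro (fun n => w n) n wn)) => j wj jmin;
    exists j; split=> // i ij; apply/negbTE/negP => /jmin; rewrite leqNgt ij.
left; apply/funext => n; have : forall n, w n = false.
  by move=> m; apply/negbTE/negP => wm; apply: w0; exists m.
rewrite /act_b; elim: n w {w0} => [|n IHn] w w0 //=.
by rewrite w0 IHn // => m; apply: w0.
Qed.

(** * Walks of bounded length *)

Fixpoint rwalk (T : Type) (E : T -> T -> Prop) (n : nat) (x y : T) : Prop :=
  if n is m.+1 then exists2 u, E x u & rwalk E m u y else x = y.

(** The pair [u], [u'] is the first [F']-step of the walk and [v], [v'] the last; the two may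
    coincide. *)
Lemma rwalk_split (T : Type) (E F F' : T -> T -> Prop) n x y :
  (forall u v, E u v -> F u v \/ F' u v) -> rwalk E n x y ->
  rwalk F n x y \/ exists n1 n2 n3 u u' v v',
    [/\ rwalk F n1 x u /\ F' u u', rwalk E n3 u' y,
        F' v v' /\ rwalk F n2 v' y, (n1 + n2 < n)%N & (n1 + n3 < n)%N].
Proof.
move=> EF; elim: n x => [|n IHn] x /=; first by left.
case=> z /EF xz /[dup] zy /IHn[{}zy'|]; last first.
  move=> [n1 [n2 [n3 [u [u' [v [v' [[zu uu'] u'y vv'y n12 n13]]]]]]]].
  case: xz => xz; right.
    by exists n1.+1, n2, n3, u, u', v, v'; split=> //; first by split=> //; exists z.
  by exists 0%N, n2, n, x, z, v, v'; split=> //; lia.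
case: xz => xz; first by left; exists z.
by right; exists 0%N, n, n, x, z, x, z; split=> //.
Qed.

Section Walks.
Variable w : binseq.
Implicit Types (z y : int) (i j k n : nat).

Definition link j z y :=
  [/\ lead j (shift z w), lead j (shift y w) & `|y - z| = (2 ^ j.+1)%:Z].

(** The first disjunct covers the edges of [a] in both directions and the loop of [b] at the zero
    sequence. *)
Definition step (P : nat -> Prop) z y :=
  `|y - z| <= 1 \/ exists2 j, P j & link j z y.

Notation low k := (step (fun j => (j < k)%N)).

Lemma zeros_dvd k z y :
  zeros k (shift z w) -> zeros k (shift y w) -> ((2 ^ k)%:Z %| y - z)%Z.
Proof.
move=> kz ky; apply: (@shift_dvd _ _ (shift z w)) => i ik.
by rewrite -shiftD subrK kz// ky.
Qed.

Lemma low_dist k n z y : rwalk (low k) n z y -> `|y - z| <= (n * 2 ^ k)%:Z.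
Proof.
elim: n z => [|n IHn] z /=; first by move=> ->; rewrite subrr.
case=> u zu /IHn; have k0 : (0 < 2 ^ k)%N by rewrite expn_gt0.
(* A link of level j < k has length 2^(j+1), at most 2^k. *)
have : `|u - z| <= (2 ^ k)%:Z.
  case: zu => [|[j jk [_ _ ->]]]; first by move: (2 ^ k)%N k0; lia.
  by rewrite lez_nat leq_exp2l.
rewrite mulSn; move: (n * 2 ^ k)%N (2 ^ k)%N; lia.
Qed.

Lemma low_split (P : nat -> Prop) k n z y : rwalk (step P) n z y ->
  rwalk (low k) n z y \/ exists n1 n2 n3 u u' v v',
    [/\ rwalk (low k) n1 z u /\ (exists j, [/\ (k <= j)%N, P j & link j u u']),
        rwalk (step P) n3 u' y,
        (exists j, [/\ (k <= j)%N, P j & link j v v']) /\ rwalk (low k) n2 v' y,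
        (n1 + n2 < n)%N & (n1 + n3 < n)%N].
Proof.
apply: rwalk_split => u v [uv|[j Pj uv]]; first by left; left.
by have [kj|jk] := leqP k j; [right; exists j|left; right; exists j].
Qed.

(* A walk that uses a link of level at least 'C(i.+1, 2) contains two excursions
   of the previous stage, one before the first such link and one after the last;
   a walk that uses none is too slow to cover 2 ^ 'C(i.+2, 2). *)
Lemma low_closed i n z y :
  rwalk (low 'C(i.+1, 2)) n z y -> (n < 2 ^ i)%N ->
  zeros 'C(i.+1, 2) (shift z w) -> zeros 'C(i.+1, 2) (shift y w) -> z = y.
Proof.
elim: i n z y => [|i IHi] n z y; first by case: n.
have -> : 'C(i.+2, 2) = ('C(i.+1, 2) + i.+1)%N by rewrite binS bin1.
move: 'C(i.+1, 2) IHi => k IHi zy n2 kz ky.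
have le_zeros u j : (k <= j)%N -> lead j (shift u w) -> zeros k (shift u w).
  by move=> kj /lead_zeros; apply.
have sub_zeros u : zeros (k + i.+1) (shift u w) -> zeros k (shift u w).
  by move=> u0 j jk; apply: u0; lia.
have [{}zy|] := low_split k zy.
  have := low_dist zy; have /dvdzP[q qE] := zeros_dvd kz ky.
  have n2' : (n * 2 ^ k < 2 ^ (k + i.+1))%N by rewrite addnC expnD ltn_pmul2r ?expn_gt0.
  have [q0|q0] := eqVneq q 0; first by move: qE; rewrite q0 mul0r; lia.
  by rewrite qE; move: n2'; move: (n * 2 ^ k)%N (2 ^ (k + i.+1))%N; nia.
move=> [n1 [n2' [n3 [u [u' [v [v' [zu_ _ vy_ n12 _]]]]]]]].
have [[zu [j [kj jk [lu _ _]]]] [[j' [kj' jk' [_ lv' _]]] v'y]] := (zu_, vy_).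
have n1i : (2 ^ i <= n1)%N.
  (* A shorter excursion would be closed, giving z = u; but [u] has valuation j < k + i + 1, while
     [z] is divisible by 2^(k+i+1). *)
  rewrite leqNgt; apply/negP => n1i.
  have zu' := IHi _ _ _ zu n1i (sub_zeros _ kz) (le_zeros _ _ kj lu).
  by apply: (lead_nzeros lu jk); rewrite -zu'.
have n2i : (2 ^ i <= n2')%N.
  rewrite leqNgt; apply/negP => n2i.
  have yv' := IHi _ _ _ v'y n2i (le_zeros _ _ kj' lv') (sub_zeros _ ky).
  by apply: (lead_nzeros lv' jk'); rewrite yv'.
by move: n2; rewrite expnS; move: (2 ^ i)%N n1i n2i; lia.
Qed.

(* A walk of length less than 2 ^ i travels along at most one line of level at
   least 'C(i.+1, 2), since its excursions from that line are closed. *)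
Lemma walk_one_line i n z y (P : nat -> Prop) :
  let k := 'C(i.+1, 2) in
  rwalk (step P) n z y -> (n < 2 ^ i)%N ->
  `|y - z| < (2 ^ (i + k))%:Z \/
  exists l d1 d2 m, [/\ lead l (shift (z + d1) w),
    y = z + d1 + m * (2 ^ l.+1)%:Z + d2,
    `|d1| < (2 ^ (i + k))%:Z, `|d2| < (2 ^ (i + k))%:Z & `|m| < (2 ^ i)%:Z].
Proof.
move=> k zy ni.
have near n' u v : (n' < 2 ^ i)%N -> rwalk (low k) n' u v ->
    `|v - u| < (2 ^ (i + k))%:Z.
  move=> n'i /low_dist uv; apply: le_lt_trans uv _.
  by rewrite ltz_nat expnD ltn_pmul2r ?expn_gt0.
(* Strong induction on the length: by [low_closed] each excursion returns to the point [u] it left,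
   so the next high link starts there, has the same level [l], and changes [m] by one. *)
have along n' l u : (n' < 2 ^ i)%N -> rwalk (step P) n' u y -> (k <= l)%N ->
    lead l (shift u w) ->
    exists d2 m, [/\ y = u + m * (2 ^ l.+1)%:Z + d2,
      `|d2| < (2 ^ (i + k))%:Z & `|m| <= n'%:Z].
  elim/ltn_ind: n' u => n' IHn' u n'i uy kl lu.
  have [{}uy|] := low_split k uy.
    by exists (y - u), 0; split; [lia|exact: near uy|].
  move=> [n1 [_ [n3 [v [v' [_ [_ [[uv [j [kj Pj [lv lv' vv']]]] v'y _ _ n13]]]]]]]].
  have n1i : (n1 < 2 ^ i)%N by lia.
  have uvE : u = v by apply: low_closed uv n1i _ _; [exact: lead_zeros lu _|exact: lead_zeros lv _].
  have jl : j = l by apply: lead_inj lv _; rewrite -uvE.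
  have [|||d2 [m [yE d2s mn]]] := IHn' n3 _ v' _ v'y kl; try lia.
    by rewrite -jl.
  have [vE|vE] : v' = v + (2 ^ l.+1)%:Z \/ v' = v - (2 ^ l.+1)%:Z.
      by move: vv'; rewrite jl; move: (2 ^ l.+1)%N; lia.
    by exists d2, (m + 1); split; [rewrite yE vE uvE; lia| |lia].
  by exists d2, (m - 1); split; [rewrite yE vE uvE; lia| |lia].
have [{}zy|] := low_split k zy; first by left; apply: near zy.
move=> [n1 [_ [n3 [v [v' [_ [_ [[zv [j [kj Pj [lv lv' vv']]]] v'y _ _ n13]]]]]]]].
(* The line is followed from [v], before the first high link, hence the length [n3.+1]. *)
right; have [||d2 [m [yE d2s mn]]] := along n3.+1 j v _ _ kj lv; first by lia.
  by exists v' => //; right; exists j.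
exists j, (v - z), d2, m; split=> //; first by rewrite addrC subrK.
- by rewrite yE; lia.
- by apply: near zv; lia.
- by lia.
Qed.
End Walks.

(** * Balls in the Schreier graph *)

Section GraphBalls.
Variable X : graph.
Implicit Types u v : vertex X.

Lemma ball_catE m n v u :
  ball v (m + n) u <-> exists2 y, ball v m y & ball y n u.
Proof.
have split_walk k l x y : walk (k + l) x y ->
    exists2 z : vertex X, walk k x z & walk l z y.
  elim: k x => [|k IHk] x /=; first by exists x.
  by case=> z xz /IHk[t zt ty]; exists t => //; exists z.
split=> [/ballP[k kmn vu]|[y /ballP[k km vy] /ballP[l ln yu]]].
  have [km|/ltnW mk] := leqP k m.
    by exists u; apply/ballP; [exists k|exists 0%N].
  move: vu; rewrite -(subnKC mk) => /split_walk[y vy yu].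
  by exists y; apply/ballP; [exists m|exists (k - m)%N => //; lia].
by apply/ballP; exists (k + l)%N; [exact: leq_add|exact: walk_cat yu].
Qed.

Lemma ballS m n v u : (m <= n)%N -> ball v m u -> ball v n u.
Proof. by move=> mn /ballP[k km vu]; apply/ballP; exists k => //; lia. Qed.

Lemma growth_fun_le v m n :
  bounded_valence X -> (m <= n)%N -> (growth_fun v m <= growth_fun v n)%N.
Proof.
move=> bX mn; apply: fsubset_leq_card; rewrite -fset_set_sub; try exact: finite_ball.
by move=> u; apply: ballS.
Qed.

(* The same N maps cover the balls of radius n around all vertices: this is what
   makes covers compose. *)
Definition covered n N := exists2 I : finType, #|I| = N &
  exists f : I -> vertex X -> vertex X,
    forall v u, ball v n u -> exists i, u = f i v.

Lemma covered_iter n N q : covered n N -> covered (q * n) (N ^ q).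
Proof.
move=> [I IN [f fP]]; elim: q => [|q [J JN [g gP]]].
  exists unit; first by rewrite card_unit.
  exists (fun _ => id) => v u /ballP[k]; rewrite leqn0 => /eqP-> /= ->.
  by exists tt.
exists (I * J)%type; first by rewrite card_prod IN JN expnS.
exists (fun c => g c.2 \o f c.1) => v u; rewrite mulSn.
by move=> /ball_catE[y /fP[i ->] /gP[j ->]]; exists (i, j).
Qed.

Lemma covered_growth n N v : covered n N -> (growth_fun v n <= N)%N.
Proof.
move=> [I <- [f fP]]; have sub : ball v n `<=` range (f^~ v).
  by move=> u /fP[i ->]; exists i.
have fin : finite_set (range (f^~ v)) by apply: finite_image; exact: finite_finset.
apply: (@leq_trans #|` fset_set (range (f^~ v))|).
  apply: fsubset_leq_card; rewrite -fset_set_sub//.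
  exact: sub_finite_set fin.
have -> : fset_set (range (f^~ v)) = [fset f i v | i : I]%fset.
  apply/fsetP => u; rewrite in_fset_set// ; apply/idP/imfsetP => /=.
    by move=> /set_mem[i _ <-]; exists i.
  by move=> [i _ ->]; apply/mem_set; exists i.
by apply: leq_trans (leq_imfset_card _ _ _) _; rewrite /= cardE.
Qed.

Lemma growth_ge n N (f : nat -> vertex X) v : bounded_valence X ->
  {in gtn N &, injective f} -> (forall i, (i < N)%N -> ball v n (f i)) ->
  (N <= growth_fun v n)%N.
Proof.
move=> bX f_inj fP; rewrite -[N in (N <= _)%N]card_ord.
pose g (i : 'I_N) := f i.
have g_inj : injective g.
  by move=> i j /f_inj ij; apply: val_inj; apply: ij; rewrite inE.
have -> : #|'I_N| = #|` [fset g i | i : 'I_N]%fset|.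
  by rewrite card_imfset //= cardE.
apply: fsubset_leq_card; apply/fsubsetP => u /imfsetP[i _ ->].
by rewrite in_fset_set; [apply/mem_set/fP|exact: finite_ball].
Qed.

End GraphBalls.

(** * The Schreier graph in integer coordinates *)

Section SchreierGraph.
Variable omega : binseq.
Notation V := (vertex (Schreier omega)).
Implicit Types (u v x : V).

Lemma G_shift z : G (shift z).
Proof.
have Ga : G act_a by apply: generated_gen; left.
have Gi : G inv_a by apply: generated_inv Ga act_aK inv_aK.
have Giter f n : G f -> G (iter n f).
  by move=> Gf; elim: n => [|n IHn]; [exact: generated_id|exact: generated_comp Gf IHn].
by case: z => n; [exact: Giter|exact: (Giter _ n.+1)].
Qed.

Lemma orbit_shift z v : Defs.orbit omega (shift z (\val v)).
Proof.
have [g Gg gv] := set_mem (valP v); exists (shift z \o g); last by rewrite -gv.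
by apply: generated_comp Gg; apply: G_shift.
Qed.

Definition vshift z v : V :=
  exist _ (shift z (\val v)) (mem_set (orbit_shift z v)).

Lemma val_vshift z v : \val (vshift z v) = shift z (\val v).
Proof. by []. Qed.

Lemma vshift0 v : vshift 0 v = v.
Proof. exact: val_inj. Qed.

Lemma vshiftD z y v : vshift (z + y) v = vshift z (vshift y v).
Proof. by apply: val_inj; rewrite !val_vshift shiftD. Qed.

Lemma vshift_inj v : injective (vshift^~ v).
Proof. by move=> z y /(congr1 val); apply: shift_inj. Qed.

(** Both orientations are recorded because walks in the undirected graph may cross an edge
    backwards. *)
Lemma act_step x z s : exists2 y,
  vertex_act s (vshift z x) = vshift y x &
  step (\val x) (fun=> True) z y /\ step (\val x) (fun=> True) y z.
Proof.
have sh y : act s (shift z (\val x)) = shift y (\val x) ->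
  vertex_act s (vshift z x) = vshift y x by move=> e; apply: val_inj.
case: s sh => sh; last first.
  by exists (z + 1); [apply: sh; rewrite shift_succ|split; left; lia].
have [bz|[j lz]] := act_b_cases (shift z (\val x)).
  by exists z; [exact: sh|split; left; lia].
exists (z + (2 ^ j.+1)%:Z).
  by apply: sh; rewrite addrC shiftD -act_b_lead.
have ly : lead j (shift (z + (2 ^ j.+1)%:Z) (\val x)).
  by rewrite addrC shiftD -[Posz _]mul1r; apply: lead_shift.
by split; right; exists j => //; split=> //; lia.
Qed.

Lemma walk_rwalk n x z v : walk n (vshift z x) v ->
  exists2 y, v = vshift y x & rwalk (step (\val x) (fun=> True)) n z y.
Proof.
elim: n z => [|n IHn] z /=; first by move=> <-; exists z.
case=> u [[p s] e] uv.
suff [y uE zy] : exists2 y, u = vshift y x & step (\val x) (fun=> True) z y.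
  by move: uv; rewrite uE => /IHn[t -> yt]; exists t => //; exists y.
case: e => e.
  have e1 : p = vshift z x := congr1 fst e.
  have e2 : vertex_act s p = u := congr1 snd e.
  have [y uE [zy _]] := act_step x z s.
  by exists y => //; rewrite -e2 e1.
have e1 : p = u := congr1 fst e.
have e2 : vertex_act s p = vshift z x := congr1 snd e.
(* For an edge crossed backwards, [p] is recovered from its image, which is a shift of [p] by some
   [d]. *)
have [y pE] : exists y, p = vshift y x.
  have [d] := act_step p 0 s; rewrite vshift0 => pd _.
  by exists (- d + z); rewrite vshiftD -e2 pd -vshiftD addNr vshift0.
have [t tE [yt ty]] := act_step x y s.
exists y; first by rewrite -e1.
by have <- : t = z by apply: (@vshift_inj x); rewrite /= -tE -pE.
Qed.

(** A map is coded by the triple d1, m, d2 of [walk_one_line]; the level is read off at the point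
    reached after d1. With 2k = i(i+1), the codes take 2(i+k+1) + (i+1) = (i+1)(i+3) bits. *)
Lemma covered_Schreier i :
  covered (Schreier omega) (2 ^ i).-1 (2 ^ (i.+1 * i.+3)).
Proof.
set k := 'C(i.+1, 2).
pose code p (c : 'I_(2 ^ p.+1)) : int := (c : nat)%:Z - (2 ^ p)%:Z.
have codeP p d : `|d| < (2 ^ p)%:Z -> exists c, d = @code p c.
  move=> dp; have lt_c : (absz (d + (2 ^ p)%:Z)%R < 2 ^ p.+1)%N.
    by rewrite expnS; move: (2 ^ p)%N dp; lia.
  by exists (Ordinal lt_c); rewrite /code /=; move: (2 ^ p)%N dp {lt_c}; lia.
(* The default 0 at the zero sequence is harmless: walks that need no line are coded with m = 0. *)
pose level (w : binseq) := xget 0%N [set l | lead l w].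
have levelE l w : lead l w -> level w = l.
  by move=> lw; apply: (@lead_inj _ _ w) => //; apply: (@xgetI _ _ [set l | lead l w] l).
exists ('I_(2 ^ (i + k).+1) * 'I_(2 ^ i.+1) * 'I_(2 ^ (i + k).+1))%type.
  rewrite !card_prod !card_ord -!expnD; congr (2 ^ _)%N.
  have : (k * 2 = i.+1 * i)%N by rewrite mulnC -(mul_bin_diag i.+1 1) bin1.
  nia.
exists (fun c v => let d1 := code _ c.1.1 in
  vshift (d1 + code _ c.1.2 * (2 ^ (level (shift d1 (\val v))).+1)%:Z
          + code _ c.2) v).
move=> v u /ballP[n ni]; rewrite -(vshift0 v) => /walk_rwalk[y uE vu].
have n2 : (n < 2 ^ i)%N by have := expn_gt0 2 i; lia.
have i0 : 0 < (2 ^ i)%:Z by rewrite ltz_nat expn_gt0.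
have ik0 : 0 < (2 ^ (i + k))%:Z by rewrite ltz_nat expn_gt0.
have [c0 c0E] : exists c, 0 = code (i + k)%N c by apply: codeP; rewrite normr0.
have [m0 m0E] : exists c, 0 = code i c by apply: codeP; rewrite normr0.
have [ys|[l [d1 [d2 [m [ll yE /codeP[c1 d1E] /codeP[c2 d2E] /codeP[c3 mE]]]]]]] :=
    walk_one_line vu n2.
  have [c cE] := codeP _ _ ys; exists (c, m0, c0).
  by rewrite /= -cE -m0E -c0E uE vshift0; congr vshift; lia.
exists (c1, c3, c2); rewrite /= -d1E -d2E -mE uE vshift0.
by move: ll yE; rewrite !add0r => /levelE-> ->.
Qed.

(** * Short routes and growth bounds *)

Lemma ball_act s v : ball v 1 (vertex_act s v).
Proof.
by apply/ballP; exists 1%N => //; exists (vertex_act s v) => //; exists (v, s); left.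
Qed.

(** Uniform in [x], since [near_add] uses it both before and after travelling along a line. *)
Definition near D k :=
  forall x i, (i <= 2 ^ k)%N -> ball x D (vshift i%:Z x).

Lemma near_add D j t : near D j.+1 -> near (2 * D + 2 ^ t) (j.+1 + t).
Proof.
move=> DP x i ile.
have walkb r v : lead j (\val v) -> ball v r (vshift (r%:Z * (2 ^ j.+1)%:Z) v).
  move=> lv; elim: r => [|r IHr].
    by rewrite mul0r vshift0; apply/ballP; exists 0%N.
  rewrite -addn1; apply/ball_catE; exists (vshift (r%:Z * (2 ^ j.+1)%:Z) v) => //.
  rewrite PoszD mulrDl mul1r addrC vshiftD.
  have -> : vshift (2 ^ j.+1)%:Z (vshift (r%:Z * (2 ^ j.+1)%:Z) v) =
      vertex_act true (vshift (r%:Z * (2 ^ j.+1)%:Z) v).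
    by apply: val_inj; rewrite val_vshift -act_b_lead//; exact: lead_shift.
  exact: ball_act.
have [p p2 lp] := lead_reach j (\val x).
have [ip|pi] := leqP i p.
  by apply: ballS (DP x i _); lia.
(* Division by 2^(j+1) gives the number [r] of links to follow and the remainder [s] to finish
   with. *)
set e := (i - p)%N.
have eE := divn_eq e (2 ^ j.+1).
have s2 : (e %% 2 ^ j.+1 < 2 ^ j.+1)%N by rewrite ltn_mod expn_gt0.
have r2 : (e %/ 2 ^ j.+1 <= 2 ^ t)%N.
  rewrite -ltnS ltn_divLR ?expn_gt0// mulSn -expnD addnC.
  by move: ile; rewrite /e addnC; have := expn_gt0 2 j.+1; lia.
move: (e %/ _)%N (e %% _)%N eE s2 r2 => r s eE s2 r2.
have -> : vshift i%:Z x = vshift s%:Z (vshift (r%:Z * (2 ^ j.+1)%:Z) (vshift p%:Z x)).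
  rewrite -!vshiftD; congr (vshift _ x).
  by rewrite -PoszM -!PoszD; congr Posz; lia.
apply: (@ballS _ (D + (r + D))); first by lia.
apply/ball_catE; exists (vshift p%:Z x); first by apply: DP; lia.
apply/ball_catE; exists (vshift (r%:Z * (2 ^ j.+1)%:Z) (vshift p%:Z x)).
  exact: walkb.
by apply: DP; lia.
Qed.

Lemma near_iter t m : near (2 ^ m * (2 + 2 ^ t)) (t * m).+1.
Proof.
(* This radius solves D(m+1) = 2 D(m) + 2^t with D(0) = 2. *)
suff H : near (2 ^ m * (2 + 2 ^ t) - 2 ^ t) (t * m).+1.
  by move=> x i /(H x); exact: ballS (leq_subr _ _).
elim: m => [|m IHm].
  rewrite muln0 mul1n addnK => x i i2; apply: ballS i2 _; elim: i => [|i IHi].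
    by apply/ballP; exists 0%N => //; rewrite vshift0.
  rewrite -addn1; apply/ball_catE; exists (vshift i%:Z x) => //.
  rewrite PoszD addrC vshiftD.
  have -> : vshift 1 (vshift i%:Z x) = vertex_act false (vshift i%:Z x).
    exact: val_inj.
  exact: ball_act.
have := @near_add _ _ t IHm.
have -> : ((t * m).+1 + t = (t * m.+1).+1)%N by rewrite [RHS]/= mulnSr.
have -> // : (2 * (2 ^ m * (2 + 2 ^ t) - 2 ^ t) + 2 ^ t = 2 ^ m.+1 * (2 + 2 ^ t) - 2 ^ t)%N.
by rewrite expnS; have := expn_gt0 2 m; move: (2 ^ m)%N (2 ^ t)%N; nia.
Qed.

Lemma Schreier_growth_ge t m v :
  (2 ^ (t * m) <= growth_fun v (2 ^ m * (2 + 2 ^ t)))%N.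
Proof.
apply: (@growth_ge _ _ _ (fun i => vshift i%:Z v)).
- exact: Schreier_bounded.
- by move=> i j _ _ /vshift_inj[].
- by move=> i i2; apply: near_iter; rewrite expnS; lia.
Qed.

Lemma Schreier_growth_le i q v :
  (growth_fun v (q * (2 ^ i).-1) <= 2 ^ (i.+1 * i.+3 * q))%N.
Proof.
by rewrite expnM; apply: covered_growth; apply: covered_iter; apply: covered_Schreier.
Qed.

End SchreierGraph.

(** * Intermediate growth *)

Lemma quadratic_lt_exp c : exists i, (0 < i)%N /\ (i.+1 * i.+3 * c < 2 ^ i)%N.
Proof.
(* Here 2^i is the fourth power of 2^(4c+4), hence at least (4c+5)^4, while the left side is only
   cubic in c. *)
exists (4 * (4 * c + 4))%N; split; [lia|rewrite [X in (_ < 2 ^ X)%N]mulnC expnM].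
have := ltn_expl (4 * c + 4) (isT : (1 < 2)%N).
move: (2 ^ (4 * c + 4))%N => x lt_x.
have : ((4 * c + 5) ^ 4 <= x ^ 4)%N by rewrite leq_exp2r//; lia.
apply: leq_trans; nia.
Qed.

Section RealEstimates.
Variable R : realType.

Lemma exp2_quadratic_le (a : R) c : 1 < a ->
  exists i, (0 < i)%N /\ 2 ^+ (i.+1 * i.+3 * c) <= a ^+ (2 ^ i).-1.
Proof.
move=> a1.
have bernoulli n : 1 + n%:R * (a - 1) <= a ^+ n.
  elim: n => [|n IHn]; first by rewrite mul0r addr0.
  rewrite exprS; apply: le_trans (ler_wpM2l _ IHn); last by lra.
  have : 0 <= n%:R * (a - 1) ^+ 2 by rewrite mulr_ge0 ?sqr_ge0.
  by rewrite -natr1; nra.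
pose M := Num.bound (a - 1)^-1.
have aM : 2 <= a ^+ M.
  apply: le_trans (bernoulli M); rewrite -[2]/(1 + 1) lerD2l -ler_pdivrMr ?subr_gt0//.
  by rewrite mul1r; apply/ltW/archi_boundP; rewrite invr_ge0; lra.
(* As a^M is at least 2, the exponent only grows by the factor M; strictness below 2^i yields the
   bound by the predecessor. *)
have [i [i0 iM]] := quadratic_lt_exp (c * M).
exists i; split=> //; apply: (@le_trans _ _ (a ^+ M ^+ (i.+1 * i.+3 * c))).
  by apply: lerXn2r => //; rewrite nnegrE; lra.
by rewrite -exprM ler_weXn2l ?ltW//; have := expn_gt0 2 i; lia.
Qed.

Lemma horner_le_pow (P : {poly R}) : exists2 M : R, 0 <= M &
  forall n, (0 < n)%N -> P.[n%:R] <= M * n%:R ^+ size P.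
Proof.
exists (\sum_(i < size P) `|P`_i|); first by apply: sumr_ge0.
move=> n n0; rewrite horner_coef mulr_suml ler_sum// => i _.
apply: (@le_trans _ _ (`|P`_i| * n%:R ^+ i)).
  by rewrite ler_wpM2r ?ler_norm ?exprn_ge0.
by rewrite ler_wpM2l// ler_weXn2l ?ler1n// ltnW.
Qed.

End RealEstimates.

Lemma Schreier_growth_superpoly omega (v : vertex (Schreier omega)) t n :
  (0 < n)%N -> (n ^ t <= growth_fun v (2 * (2 + 2 ^ t) * n))%N.
Proof.
(* Take m with 2^m <= n < 2^(m+1): the lower bound on n controls the radius, the upper bound
   controls n^t. *)
move=> n0; have /andP[mn nm] := trunc_log_bounds (isT : (1 < 2)%N) n0.
move: (trunc_log 2 n) mn nm => m mn nm.
apply: (@leq_trans (2 ^ (t * m.+1))).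
  by rewrite mulnC expnM; case: t => // t; rewrite leq_exp2r// ltnW.
apply: leq_trans (Schreier_growth_ge _ _ _) _.
apply: growth_fun_le; first exact: Schreier_bounded.
by rewrite expnS; nia.
Qed.

Theorem theorem13 (R : realType) (omega : binseq) :
  intermediate_growth R (Schreier omega).
Proof.
have bX := Schreier_bounded omega.
move=> v gamma; split=> [P P0|a a1].
  have [M M0 PM] := horner_le_pow P; set t := size P in PM.
  (* The exponent [t.+1] exceeds the exponent [t] in the bound on [P] by one, so that the comparison
     is strict. *)
  pose c := (2 * (2 + 2 ^ t.+1))%N.
  have gc n : (0 < n)%N -> n%:R ^+ t.+1 <= gamma (c * n)%N.
    by move=> n0; rewrite -natrX ler_nat; apply: Schreier_growth_superpoly.
  split.
    exists c, (Num.bound M).+1; split=> // n Mn.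
    apply: le_trans (gc n _); last by lia.
    apply: le_trans (PM n _) _; first by lia.
    rewrite exprS ler_wpM2r ?exprn_ge0//.
    by apply/ltW/(lt_trans (archi_boundP M0)); rewrite ltr_nat.
  (* Otherwise n^(t+1) <= gamma(cn) <= P(Ccn) <= B n^t, which fails once n > B. *)
  move=> [_ [C [n0 [C0 gP]]]].
  pose B := M * (C * c)%:R ^+ t.
  have B0 : 0 <= B by rewrite mulr_ge0 ?exprn_ge0.
  pose n := (n0 + Num.bound B).+1.
  have : n%:R ^+ t.+1 <= B * n%:R ^+ t.
    apply: le_trans (gc n isT) _; apply: le_trans (gP _ _) _.
      by rewrite /n /c; nia.
    apply: le_trans (PM _ _) _; first by rewrite /n /c; nia.
    by rewrite mulnA natrM exprMn mulrA.
  rewrite exprS ler_pM2r ?exprn_gt0 ?ltr0n// leNgt.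
  by rewrite (lt_trans (archi_boundP B0))// ltr_nat /n; lia.
have gle i q : gamma (q * (2 ^ i).-1)%N <= 2 ^+ (i.+1 * i.+3 * q).
  by rewrite -natrX ler_nat; apply: Schreier_growth_le.
have d0 i : (0 < i)%N -> (0 < (2 ^ i).-1)%N.
  by move=> i0; have := ltn_expl i (isT : (1 < 2)%N); lia.
split.
  have [i [i0 ia]] := exp2_quadratic_le 1 a1.
  (* Rounding n up to a multiple of d adds at most d <= n, hence the dilation 2. *)
  exists 2%N, (2 ^ i).-1; split=> // n dn.
  set d := (2 ^ i).-1 in ia dn *; have {}d0 : (0 < d)%N := d0 i i0.
  apply: (@le_trans _ _ (gamma ((n %/ d).+1 * d)%N)).
    by rewrite ler_nat growth_fun_le// ltnW// ltn_ceil.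
  apply: le_trans (gle _ _) _; rewrite muln1 in ia.
  rewrite exprM; apply: (@le_trans _ _ (a ^+ d ^+ (n %/ d).+1)).
    by apply: lerXn2r => //; rewrite nnegrE exprn_ge0//; lra.
  rewrite -exprM ler_weXn2l ?ltW// mulnS mulnC.
  by have := leq_trunc_div n d; lia.
move=> [_ [C [n0 [C0 ag]]]].
(* The factor 2 leaves room for a square: with n = (n0+1)d and Y the bound on gamma(Cn), Y^2 <= a^n
   <= Y contradicts a^n > 1. *)
have [i [i0 ia]] := exp2_quadratic_le (C * 2) a1.
set d := (2 ^ i).-1 in ia; have {}d0 : (0 < d)%N := d0 i i0.
have := ag (n0.+1 * d)%N; rewrite mulnA => /(_ _)/le_trans/(_ (gle _ _)).
rewrite leNgt => /(_ _)/negP[]; first by nia.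
have X1 : 1 < a ^+ (n0.+1 * d) by rewrite exprn_egt1//; lia.
have Y0 : 0 <= 2 ^+ (i.+1 * i.+3 * (C * n0.+1)) :> R by rewrite exprn_ge0.
have : (2 ^+ (i.+1 * i.+3 * (C * n0.+1))) ^+ 2 <= a ^+ (n0.+1 * d).
  rewrite -exprM (_ : (_ * 2 = i.+1 * i.+3 * (C * 2) * n0.+1)%N); last by lia.
  by rewrite [leLHS]exprM [(n0.+1 * d)%N]mulnC [leRHS]exprM lerXn2r// nnegrE exprn_ge0//; lra.
nra.
Qed.
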